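(* Let $L\ge1$ be an integer, and let $X_n$ and $X_n^{(Q)}$ be as defined in the context. For all positive integers $Q$ and $K$, the expectation $\mathbb{E}\left[\frac{1}{\sqrt{K}}\sum_{n=1}^K(X_n-X_n^{(Q)})\right]$ and the variance $\mathrm{Var}\left[\frac{1}{\sqrt{K}}\sum_{n=1}^K(X_n-X_n^{(Q)})\right]$ exist (are finite), and for every positive integer $Q$ $$\lim_{K\to\infty}\mathbb{E}\left[\frac{1}{\sqrt{K}}\sum_{n=1}^K(X_n-X_n^{(Q)})\right]=0,\qquad \lim_{K\to\infty}\mathrm{Var}\left[\frac{1}{\sqrt{K}}\sum_{n=1}^K(X_n-X_n^{(Q)})\right]=0.$$
   Context: Let $(b_n)_{n\in\mathbb{Z}}$ be i.i.d. random blocks uniformly distributed on $\{0,1\}^L$ (independent fair bits). For $n\ge1$ let $A_n=\min\{m\in\mathbb{N}: m\ge1,\ b_{n-m}=b_n\}$, which is almost surely finite. Let $g(i)=\frac{1}{\ln 2}\sum_{j=1}^{i-1}\frac1j$ for integers $i\ge1$ (so $g(1)=0$), and $X_n=g(A_n)$. For a positive integer $Q$ (number of initialization blocks) define $$X_n^{(Q)}=\begin{cases}X_n & \text{if } A_n\le Q+n-1,\\ g(Q+n-1)&\text{otherwise.}\end{cases}$$ *)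

(* Defs.v *)
From HB Require Import structures.
From mathcomp Require Import all_boot all_order all_algebra.
From mathcomp Require Import all_classical all_reals all_analysis.

Set Implicit Arguments.
Unset Strict Implicit.
Unset Printing Implicit Defensive.
Import Order.TTheory GRing.Theory Num.Theory.
Import numFieldNormedType.Exports.

Local Open Scope classical_set_scope.
Local Open Scope ring_scope.

Definition mutually_independent d (T : measurableType d) d' (U : measurableType d')
    (R : realType) (P : probability T R) (I : choiceType)
    (X : I -> {RV P >-> U}) : Prop :=
  forall (s : seq I) (E : I -> set U), uniq s -> (forall i, measurable (E i)) ->
    P (\bigcap_(i in [set` s]) X i @^-1` E i) =
      (\prod_(i <- s) P (X i @^-1` E i))%E.

(* The law of L independent fair bits gives mass 2^-L to each word. *)
Definition uniform_block d (T : measurableType d) (R : realType)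
    (P : probability T R) (L : nat) (X : {RV P >-> L.-tuple bool}) : Prop :=
  forall w : L.-tuple bool, distribution P X [set w] = (2^-1 ^+ L)%:E.

Section recurrence_statistic.
Variables (R : realType) (T : Type) (B : eqType) (b : int -> T -> B).

Definition recurs (n : nat) (t : T) (m : nat) : bool :=
  (1 <= m)%N && (b (n%:Z - m%:Z) t == b n%:Z t).

(* The value 0 stands for an infinite recurrence time; for i.i.d. uniform
   blocks this only happens on a null set. *)
Definition recurrence_time (n : nat) (t : T) : nat :=
  match pselect (exists m, recurs n t m) with
  | left ex => ex_minn ex
  | right _ => 0%N
  end.

Definition coron_g (i : nat) : R := (ln 2)^-1 * \sum_(1 <= j < i) j%:R^-1.

Definition stat (n : nat) (t : T) : R := coron_g (recurrence_time n t).

Definition stat_trunc (Q n : nat) (t : T) : R :=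
  if (recurrence_time n t <= Q + n - 1)%N then stat n t
  else coron_g (Q + n - 1).

Definition scaled_error (Q K : nat) (t : T) : R :=
  (Num.sqrt K%:R)^-1 * \sum_(1 <= n < K.+1) (stat n t - stat_trunc Q n t).

End recurrence_statistic.

(* Main.v *)
(** The n-th error [X_n - X_n^(Q)] vanishes unless [A_n > N := Q + n - 1], and
    then it is [(ln 2)^-1] times a segment of the harmonic series of length
    [A_n - N], whose square is at most [3 (A_n - N)]. Writing [A_n - N] as the sum
    over [m >= N] of the indicators of [A_n > m], events of probability
    [(1 - 2^-L)^m], its second moment decays geometrically in [n]. Hence the
    second moment of the unscaled sum is bounded uniformly in [K], and the factor
    [K^(-1/2)] sends both the expectation and the variance to 0. *)
Require Import Defs.
From HB Require Import structures.
From mathcomp Require Import all_boot all_order all_algebra.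
From mathcomp Require Import all_classical all_reals all_analysis.
From mathcomp Require Import measurable_realfun ring lra zify.

Set Implicit Arguments.
Unset Strict Implicit.
Unset Printing Implicit Defensive.
Import Order.TTheory GRing.Theory Num.Theory.
Import numFieldNormedType.Exports.

Local Open Scope classical_set_scope.
Local Open Scope ring_scope.

(** * Elementary inequalities: harmonic segments, weighted Cauchy-Schwarz, geometric sums *)

(** Induction on [k]: a new term [x = 1 / (N + k)] adds [2 h x + x ^ 2 <= 3] to the square, because
    [h <= k] gives [h x <= 1]. The linear bound on [h] is therefore carried along. *)
Lemma sqr_harmonic_segment_le (R : realFieldType) (N k : nat) : (0 < N)%N ->
  0 <= \sum_(N <= j < N + k) (j%:R^-1 : R) <= k%:R /\
  (\sum_(N <= j < N + k) (j%:R^-1 : R)) ^+ 2 <= 3 * k%:R.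
Proof.
move=> N_gt0; elim: k => [|k [/andP[h0 hk] h3]].
  by rewrite addn0 big_geq// expr0n mulr0 lexx.
rewrite addnS big_nat_recr ?leq_addr//=.
set h := \sum_(_ <= _ < _) _ in h0 hk h3 *.
have Nk_gt0 : (0 : R) < (N + k)%:R by rewrite ltr0n addn_gt0 N_gt0.
set x := (N + k)%:R^-1.
have x_ge0 : 0 <= x by rewrite invr_ge0 ltW.
have x_le1 : x <= 1 by rewrite invf_le1// ler1n addn_gt0 N_gt0.
have hx_le1 : h * x <= 1.
  rewrite ler_pdivrMr// mul1r (le_trans hk)// ler_nat leq_addl//.
have xx_le1 : x * x <= 1 by nra.
rewrite -natr1; split; first by apply/andP; split; lra.
nra.
Qed.

Lemma coron_gB (R : realType) (M N : nat) : (0 < N <= M)%N ->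
  coron_g R M - coron_g R N = (ln 2)^-1 * \sum_(N <= j < M) j%:R^-1.
Proof.
move=> /andP[N_gt0 NM].
by rewrite /coron_g (big_cat_nat N_gt0 NM)//= mulrDr addrC addKr.
Qed.

Lemma sqr_coron_gB_le (R : realType) (M N : nat) : (0 < N <= M)%N ->
  0 <= coron_g R M - coron_g R N /\
  (coron_g R M - coron_g R N) ^+ 2 <= 3 * (ln 2)^-1 ^+ 2 * (M - N)%:R.
Proof.
move=> /[dup] NM /coron_gB ->; case/andP: NM => N_gt0 NM.
have [/andP[h0 _] h3] := sqr_harmonic_segment_le R (M - N) N_gt0.
rewrite subnKC// in h0 h3.
have ln2_ge0 : 0 <= (ln 2 : R)^-1 by rewrite invr_ge0 ln_ge0// ler1n.
split; first exact: mulr_ge0.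
by rewrite exprMn [leRHS]mulrAC [leLHS]mulrC ler_wpM2r ?exprn_ge0.
Qed.

(** Cauchy-Schwarz applied to [sqrt (w n)] and [x n / sqrt (w n)], proved by induction so that no
    square root appears. *)
Lemma sqr_sum_le_weighted (R : realFieldType) (w x : nat -> R) (K : nat) :
  (forall n, 0 < w n) ->
  (\sum_(1 <= n < K.+1) x n) ^+ 2 <=
    (\sum_(1 <= n < K.+1) w n) * \sum_(1 <= n < K.+1) x n ^+ 2 / w n.
Proof.
move=> w_gt0; elim: K => [|K IHK]; first by rewrite !big_geq// expr0n mul0r.
rewrite !(@big_nat_recr _ _ _ K.+1)//=.
have := w_gt0 K.+1.
have : 0 <= \sum_(1 <= n < K.+1) w n by apply: sumr_ge0 => i _; rewrite ltW.
have : 0 <= \sum_(1 <= n < K.+1) x n ^+ 2 / w n.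
  by apply: sumr_ge0 => i _; rewrite mulr_ge0 ?sqr_ge0// invr_ge0 ltW.
move: (\sum_(_ <= _ < _) x _) (\sum_(_ <= _ < _) w _) IHK.
move: (\sum_(_ <= _ < _) _) (x K.+1) (w K.+1).
(* [S], [T], [U] are the sums of [x n], [w n], [x n ^ 2 / w n] up to [K]; [y] and [v] are the next
   [x] and [w]. *)
move=> U y v S T S2_le U_ge0 T_ge0 v_gt0.
have v_ge0 := ltW v_gt0.
have -> : (T + v) * (U + y ^+ 2 / v) = T * U + T * (y ^+ 2 / v) + v * U + y ^+ 2.
  by field; rewrite gt_eqF.
(* Cancelling [y ^ 2] and using [S ^ 2 <= T U] leaves the cross term [2 S y <= T y ^ 2 / v + v U],
   which is proved by comparing squares. *)
rewrite sqrrD lerD2r -addrA lerD//.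
have yv_ge0 : 0 <= y ^+ 2 / v by rewrite divr_ge0 ?sqr_ge0.
have ab_ge0 : 0 <= T * (y ^+ 2 / v) + v * U.
  by apply: addr_ge0; exact: mulr_ge0.
rewrite (le_trans (ler_norm _))// -(ler_pXn2r (ltn0Sn 1)) ?nnegrE//.
rewrite -normrX ger0_norm ?sqr_ge0//.
(* AM-GM: [(a + b)^2 >= 4 a b] with [a b = T U y^2] *)
apply: (@le_trans _ _ (4 * (T * (y ^+ 2 / v)) * (v * U))).
  have -> : 4 * (T * (y ^+ 2 / v)) * (v * U) = 4 * y ^+ 2 * (T * U).
    by field; rewrite gt_eqF.
  rewrite -mulr_natr; have := sqr_ge0 y; nra.
move: (T * _) (v * U) => a b; have := sqr_ge0 (a - b); nra.
Qed.

Lemma sum_expr_le (R : realType) (q : R) (m n : nat) : 0 < q < 1 ->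
  \sum_(m <= i < n) q ^+ i <= q ^+ m / (1 - q).
Proof.
move=> /andP[q_gt0 q_lt1].
have [nm|mn] := leqP n m.
  by rewrite big_geq// mulr_ge0 ?exprn_ge0 ?invr_ge0 ?subr_ge0// ltW.
rewrite -(subnKC (ltnW mn)) geometric_partial_tail geometric_le_lim//.
  by rewrite exprn_ge0// ltW.
by rewrite gtr0_norm.
Qed.

(** * Measurability of words and a finite union bound *)

(** The coordinate maps are measurable, and a single word is a finite intersection of coordinate
    cylinders. *)
Lemma measurable_bool_tuple_set1 (L : nat) (w : L.-tuple bool) :
  measurable [set w].
Proof.
have -> : [set w] =
    \bigcap_(i in [set: 'I_L]) ((@tnth L bool)^~ i @^-1` [set tnth w i]).
  apply/seteqP; split=> [_ -> //|v vw].
  by apply: eq_from_tnth => i; exact: vw.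
apply: fin_bigcap_measurable => // i _; rewrite -[X in measurable X]setTI.
exact: (@measurable_tnth _ bool L i).
Qed.

Lemma measure_bigsetU_le d (T : measurableType d) (R : realType)
    (mu : {measure set T -> \bar R}) (I : Type) (r : seq I) (A : I -> set T) :
  (forall i, measurable (A i)) ->
  (mu (\big[setU/set0]_(i <- r) A i) <= \sum_(i <- r) mu (A i))%E.
Proof.
move=> mA; elim: r => [|i r IHr]; first by rewrite !big_nil measure0.
rewrite !big_cons (le_trans (measureU2 _ _ _))// ?leeD2l//.
exact: bigsetU_measurable.
Qed.

(** * Recurrence times: measurability and geometric tail *)

Section recurrence.
Context d (T : measurableType d) (R : realType) (P : probability T R) (L : nat)
  (b : int -> {RV P >-> L.-tuple bool}).

(** The event that the true recurrence time exceeds [m], infinity included. It is phrased through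
    [recurs] because [recurrence_time] encodes infinity as 0. *)
Definition no_recurrence (n m : nat) : set T :=
  [set t | forall j, (j <= m)%N -> ~~ recurs b n t j].

Lemma measurable_recurs n j : measurable [set t | recurs b n t j].
Proof.
rewrite /recurs; case: (leqP 1 j) => _ /=; last first.
  by rewrite (_ : mkset _ = set0)//; apply/seteqP; split.
have -> : [set t | b (n%:Z - j%:Z) t == b n%:Z t] =
    \bigcup_(w in [set: L.-tuple bool])
      (b (n%:Z - j%:Z) @^-1` [set w] `&` b n%:Z @^-1` [set w]).
  apply/seteqP; split=> [t /eqP e|t [w _ [/= -> ->]]]; last exact: eqxx.
  by exists (b n%:Z t).
apply: fin_bigcup_measurable => // w _.
by apply: measurableI; apply: measurable_funPTI; exact: measurable_bool_tuple_set1.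
Qed.

Lemma measurable_no_recurrence n m : measurable (no_recurrence n m).
Proof.
have -> : no_recurrence n m = \bigcap_(j in `I_m.+1) ~` [set t | recurs b n t j].
  by apply/seteqP; split=> t h j jm; apply/negP; exact: h.
apply: fin_bigcap_measurable => // j _.
by apply: measurableC; exact: measurable_recurs.
Qed.

(** The converse fails where the block never recurs: there [recurrence_time] is 0 while
    [no_recurrence] holds for every [m]. *)
Lemma no_recurrence_lt n m t :
  (m < recurrence_time b n t)%N -> no_recurrence n m t.
Proof.
rewrite /recurrence_time; case: pselect => // ex.
case: ex_minnP => k _ kmin mk j jm; apply/negP => /kmin.
by rewrite leqNgt (leq_ltn_trans jm mk).
Qed.

Lemma recurrence_time_eqS n k : [set t | recurrence_time b n t = k.+1] =
  [set t | recurs b n t k.+1] `&` no_recurrence n k.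
Proof.
apply/seteqP; split=> t /=.
  move=> tk; split; last by apply: no_recurrence_lt; rewrite tk.
  move: tk; rewrite /recurrence_time; case: pselect => // ex.
  by case: ex_minnP => k' + _ <-.
case=> rk nk; rewrite /recurrence_time; case: pselect => [ex|]; last first.
  by case; exists k.+1.
case: ex_minnP => k' rk' /(_ _ rk); rewrite leq_eqVlt => /orP[/eqP//|].
by rewrite ltnS => /nk; rewrite rk'.
Qed.

Lemma measurable_recurrence_time n :
  measurable_fun [set: T] (recurrence_time b n).
Proof.
have mS k : measurable [set t | recurrence_time b n t = k.+1].
  rewrite recurrence_time_eqS.
  by apply: measurableI;
    [exact: measurable_recurs|exact: measurable_no_recurrence].
have m1 k : measurable [set t | recurrence_time b n t = k].
  (* The fibre over 0 consists of the points without recurrence, so it is the complement of all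
     positive fibres. *)
  case: k => // ; rewrite (_ : mkset _ =
    ~` \bigcup_k [set t | recurrence_time b n t = k.+1]).
    by apply: measurableC; exact: bigcup_measurable.
  apply/seteqP; split=> t /=; first by move=> t0 [k _]; rewrite /= t0.
  by case e : (recurrence_time b n t) => [//|k] []; exists k.
move=> _ Y _; rewrite setTI.
have -> : recurrence_time b n @^-1` Y =
    \bigcup_(k in Y) [set t | recurrence_time b n t = k].
  by apply/seteqP; split=> [t Yt|t [k Yk /= -> //]]; exists (recurrence_time b n t).
by apply: bigcup_measurable => k _.
Qed.

Lemma measurable_fun_recurrence_time (F : nat -> R) n :
  measurable_fun [set: T] (F \o recurrence_time b n).
Proof.
by apply: measurableT_comp => //; exact: measurable_recurrence_time.
Qed.

Hypothesis b_indep : mutually_independent b.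
Hypothesis b_unif : forall n : int, uniform_block (b n).

Lemma block_eq_prob (i : int) w : P (b i @^-1` [set w]) = (2^-1 ^+ L)%:E.
Proof. exact: b_unif. Qed.

Lemma block_neq_prob (i : int) w :
  P (b i @^-1` (~` [set w])) = (1 - 2^-1 ^+ L)%:E.
Proof.
rewrite -preimage_setC probability_setC ?block_eq_prob ?EFinB//.
by apply: measurable_funPTI; exact: measurable_bool_tuple_set1.
Qed.

(** Split according to the word [w] taken by block [n]. By independence, [w] at [n] and other words
    at the [m] preceding indices have joint probability [2^-L (1 - 2^-L)^m]; a union bound over the
    [2^L] words concludes. *)
Lemma no_recurrence_prob_le n m :
  (P (no_recurrence n m) <= ((1 - 2^-1 ^+ L) ^+ m)%:E)%E.
Proof.
pose s := [seq n%:Z - j%:Z | j <- iota 1 m].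
pose E (w : L.-tuple bool) (i : int) := if i == n%:Z then [set w] else ~` [set w].
pose W w := \bigcap_(i in [set` n%:Z :: s]) b i @^-1` E w i.
have mE w i : measurable (E w i).
  rewrite /E; case: ifP => _; last apply: measurableC;
    exact: measurable_bool_tuple_set1.
have mW w : measurable (W w).
  by apply: fin_bigcap_measurable => // i _; exact: measurable_funPTI.
have n_notin_s i : i \in s -> (i == n%:Z) = false.
  case/mapP => j; rewrite mem_iota => /andP[j_gt0 _] ->.
  apply/negbTE; lia.
(* Independence is stated for duplicate-free index lists. *)
have uniq_s : uniq (n%:Z :: s).
  rewrite /= map_inj_uniq ?iota_uniq ?andbT; last by move=> i j; lia.
  by apply/negP => /n_notin_s; rewrite eqxx.
have PW w : P (W w) = (2^-1 ^+ L * (1 - 2^-1 ^+ L) ^+ m)%:E.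
  rewrite b_indep// big_cons /E eqxx block_eq_prob EFinM; congr (_ * _)%E.
  rewrite (eq_big_seq (fun=> (1 - 2^-1 ^+ L)%:E)); last first.
    by move=> i /n_notin_s ->; exact: block_neq_prob.
  by rewrite prodEFin big_const_seq count_predT size_map size_iota iter_mulr_1.
have sub : no_recurrence n m `<=` \big[setU/set0]_(w : L.-tuple bool) W w.
  move=> t tm; rewrite (bigD1 (b n%:Z t))//=; left => i /=.
  rewrite inE /E => /predU1P[->|i_s]; first by rewrite eqxx.
  rewrite n_notin_s//; case/mapP: i_s => j; rewrite mem_iota add1n ltnS.
  move=> /andP[j_gt0 jm] -> /= bE.
  by have := tm _ jm; rewrite /recurs j_gt0 bE eqxx.
rewrite (@le_trans _ _ (\sum_(w : L.-tuple bool) P (W w))%E)//.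
  rewrite (le_trans _ (measure_bigsetU_le _ _ _))// le_measure// inE.
    exact: measurable_no_recurrence.
  exact: bigsetU_measurable.
(* The number [2^L] of words cancels the factor [2^-L]. *)
rewrite (eq_bigr _ (fun w _ => PW w)) sumEFin lee_fin sumr_const card_tuple card_bool.
rewrite -[leLHS]mulr_natr mulrAC natrX -exprMn mulVf ?pnatr_eq0//.
by rewrite expr1n mul1r.
Qed.

End recurrence.

(** * Second moment of a single error *)

Section error.
Context d (T : measurableType d) (R : realType) (P : probability T R) (L : nat)
  (b : int -> {RV P >-> L.-tuple bool}).

Definition stat_error (Q n : nat) (t : T) : R :=
  stat R b n t - stat_trunc R b Q n t.

(** The error depends on [t] through the recurrence time alone, which reduces its measurability to
    that of [recurrence_time]. *)
Lemma stat_errorE Q n : stat_error Q n =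
  (fun k => if (k <= Q + n - 1)%N then 0
            else coron_g R k - coron_g R (Q + n - 1)) \o recurrence_time b n.
Proof.
apply/funext => t; rewrite /stat_error /stat_trunc /stat /=.
by case: ifP => // _; rewrite subrr.
Qed.

Lemma measurable_stat_error Q n : measurable_fun [set: T] (stat_error Q n).
Proof. rewrite stat_errorE; exact: measurable_fun_recurrence_time. Qed.

Lemma stat_error_ge0 Q n t : (0 < Q)%N -> (0 < n)%N -> 0 <= stat_error Q n t.
Proof.
move=> Q_gt0 n_gt0; rewrite stat_errorE /=.
have [//|/ltnW] := leqP (recurrence_time b n t) (Q + n - 1).
move=> NA; apply: (sqr_coron_gB_le R _).1.
by rewrite NA andbT subn_gt0; lia.
Qed.

(** Layer-cake form of the linear bound: when [A > N], the length [A - N] counts the [m] with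
    [N + m < A], and [no_recurrence] holds at each such [N + m]. *)
Lemma sqr_stat_error_le Q n t : (0 < Q)%N -> (0 < n)%N ->
  ((stat_error Q n t ^+ 2)%:E <= \sum_(0 <= m <oo)
    (3 * (ln 2)^-1 ^+ 2 * \1_(no_recurrence b n (Q + n - 1 + m)) t)%:E)%E.
Proof.
move=> Q_gt0 n_gt0; rewrite stat_errorE /=.
set N := (Q + n - 1)%N; set A := recurrence_time b n t.
have C_ge0 : 0 <= 3 * (ln 2 : R)^-1 ^+ 2 by rewrite mulr_ge0 ?sqr_ge0.
have term_ge0 m : (0 <=
    (3 * (ln 2)^-1 ^+ 2 * \1_(no_recurrence b n (N + m)) t : R)%:E)%E.
  by rewrite lee_fin mulr_ge0.
(* The first case covers the default value [A = 0], where the error is 0. *)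
have [AN|NA] := leqP A N; first by rewrite expr0n nneseries_ge0.
apply: le_trans (nneseries_lim_ge (A - N) _) => //.
have -> : (\sum_(0 <= m < A - N)
    (3 * (ln 2)^-1 ^+ 2 * \1_(no_recurrence b n (N + m)) t)%:E =
    (3 * (ln 2)^-1 ^+ 2 * (A - N)%:R)%:E :> \bar R)%E.
  rewrite sumEFin; congr EFin.
  rewrite (eq_big_nat _ _ (F2 := fun=> 3 * (ln 2)^-1 ^+ 2)).
    by rewrite big_const_nat subn0 iter_addr_0 mulr_natr.
  move=> m /andP[_ mA]; rewrite indicE mem_set ?mulr1//.
  by apply: no_recurrence_lt; rewrite -/A; lia.
rewrite lee_fin; apply: (sqr_coron_gB_le R _).2.
by rewrite /N in NA *; lia.
Qed.

Variable q : R.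
Hypothesis q01 : 0 < q < 1.
Hypothesis no_recurrence_le :
  forall n m, (P (no_recurrence b n m) <= (q ^+ m)%:E)%E.

(** Integrating the layer-cake series termwise gives a geometric series with sum at most
    [q ^ N / (1 - q)]; [Q >= 1] yields [N >= n], hence [q ^ N <= q ^ n]. *)
Lemma expectation_sqr_stat_error_le Q n : (0 < Q)%N -> (0 < n)%N ->
  (\int[P]_t (stat_error Q n t ^+ 2)%:E <=
    (3 * (ln 2)^-1 ^+ 2 / (1 - q) * q ^+ n)%:E)%E.
Proof.
move=> Q_gt0 n_gt0; set N := (Q + n - 1)%N.
set C : R := 3 * (ln 2)^-1 ^+ 2.
have C_ge0 : 0 <= C by rewrite mulr_ge0 ?sqr_ge0.
have /andP[q_gt0 q_lt1] := q01.
pose f m t : \bar R :=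
  (C * \1_(no_recurrence b n (N + m)) t)%:E.
have f_ge0 m t : (0 <= f m t)%E by rewrite lee_fin mulr_ge0.
have mf m : measurable_fun [set: T] (f m).
  apply/measurable_EFinP; apply: measurable_funM => //.
  by apply: measurable_indic; exact: measurable_no_recurrence.
apply: (@le_trans _ _ (\int[P]_t \sum_(0 <= m <oo) f m t)%E).
  apply: ge0_le_integral => //.
  - by move=> t _; rewrite lee_fin sqr_ge0.
  - by apply/measurable_EFinP; apply: measurable_funX; exact: measurable_stat_error.
  - exact: ge0_emeasurable_sum.
  - by move=> t _; exact: sqr_stat_error_le.
rewrite integral_nneseries//.
apply: lime_le; first by apply: is_cvg_nneseries => m _ _; exact: integral_ge0.
apply: nearW => k.
have intf m : (\int[P]_t f m t <= (C * q ^+ (N + m))%:E)%E.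
  rewrite /f; under eq_integral do rewrite EFinM.
  rewrite ge0_integralZl_EFin//; last first.
    apply/measurable_EFinP/measurable_indic.
    exact: measurable_no_recurrence.
  rewrite integral_indic ?setIT//; last exact: measurable_no_recurrence.
  rewrite [leRHS]EFinM; apply: lee_wpmul2l; first by rewrite lee_fin.
  exact: no_recurrence_le.
rewrite (le_trans (lee_sum _ (fun m _ => intf m)))// sumEFin lee_fin.
rewrite -mulr_sumr [leRHS]mulrAC -[leRHS]mulrA ler_wpM2l//.
under eq_bigr do rewrite exprD.
rewrite -mulr_sumr; apply: ler_pM.
- by rewrite exprn_ge0// ltW.
- by apply: sumr_ge0 => i _; rewrite exprn_ge0// ltW.
- by rewrite ler_wiXn2l ?ltW// /N; lia.
- by rewrite (le_trans (sum_expr_le 0 _ q01))// expr0 div1r.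
Qed.

End error.

(** * Uniform second moment bound for the unscaled sum *)

Section total_error.
Context d (T : measurableType d) (R : realType) (P : probability T R) (L : nat)
  (b : int -> {RV P >-> L.-tuple bool}).
Variable q : R.
Hypothesis q01 : 0 < q < 1.
Hypothesis no_recurrence_le :
  forall n m, (P (no_recurrence b n m) <= (q ^+ m)%:E)%E.

Definition total_error (Q K : nat) (t : T) : R :=
  \sum_(1 <= n < K.+1) stat_error b Q n t.

Lemma measurable_total_error Q K : measurable_fun [set: T] (total_error Q K).
Proof. by apply: measurable_sum => n; exact: measurable_stat_error. Qed.

Lemma total_error_ge0 Q K t : (0 < Q)%N -> 0 <= total_error Q K t.
Proof.
move=> Q_gt0; rewrite /total_error big_nat sumr_ge0// => n /andP[n_gt0 _].
exact: stat_error_ge0.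
Qed.

(* The second moment of the n-th error is at most [C q^n]; Cauchy-Schwarz with
   weights [sqrt q ^ n] leaves two convergent geometric sums. *)
Lemma expectation_sqr_total_error_le Q K : (0 < Q)%N ->
  (\int[P]_t (total_error Q K t ^+ 2)%:E <=
    (3 * (ln 2)^-1 ^+ 2 / (1 - q) / (1 - Num.sqrt q) ^+ 2)%:E)%E.
Proof.
move=> Q_gt0; have /andP[q_gt0 q_lt1] := q01.
set s := Num.sqrt q.
have s_gt0 : 0 < s by rewrite sqrtr_gt0.
have s_lt1 : s < 1 by rewrite -sqrtr1 ltr_sqrt.
have ss : s ^+ 2 = q by rewrite sqr_sqrtr// ltW.
set C : R := 3 * (ln 2)^-1 ^+ 2 / (1 - q).
have C_ge0 : 0 <= C.
  by rewrite divr_ge0 ?subr_ge0 ?(ltW q_lt1)// mulr_ge0 ?sqr_ge0.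
have geo : \sum_(1 <= n < K.+1) s ^+ n <= (1 - s)^-1.
  rewrite (le_trans (sum_expr_le _ _ _)) ?s_gt0// expr1 ler_piMl// ?ltW//.
  by rewrite invr_gt0 subr_gt0.
have geo_ge0 : 0 <= \sum_(1 <= n < K.+1) s ^+ n.
  by apply: sumr_ge0 => n _; rewrite exprn_ge0// ltW.
have is_ge0 n : 0 <= (s ^+ n)^-1 by rewrite invr_ge0 exprn_ge0// ltW.
pose f n t : \bar R := ((s ^+ n)^-1 * stat_error b Q n t ^+ 2)%:E.
have f_ge0 n t : (0 <= f n t)%E by rewrite lee_fin mulr_ge0 ?sqr_ge0.
have msqr n : measurable_fun [set: T] (fun t => stat_error b Q n t ^+ 2).
  by apply: measurable_funX; exact: measurable_stat_error.
have mf n : measurable_fun [set: T] (f n).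
  by apply/measurable_EFinP; exact: measurable_funM.
have intf n : (0 < n)%N -> (\int[P]_t f n t <= (C * s ^+ n)%:E)%E.
  move=> n_gt0; rewrite /f; under eq_integral do rewrite EFinM.
  rewrite ge0_integralZl_EFin//; last 2 first.
  - by move=> t _; rewrite lee_fin sqr_ge0.
  - exact/measurable_EFinP.
  (* As [q = s ^ 2], dividing [q ^ n] by the weight leaves [s ^ n], which is still summable. *)
  have -> : C * s ^+ n = (s ^+ n)^-1 * (C * q ^+ n).
    rewrite -ss -exprM mul2n -addnn exprD mulrCA mulKf//.
    by rewrite expf_neq0// gt_eqF.
  rewrite [leRHS]EFinM; apply: lee_wpmul2l; first by rewrite lee_fin.
  exact: expectation_sqr_stat_error_le.
(* Pointwise Cauchy-Schwarz, with the sum of the weights replaced by its bound [1 / (1 - s)]. *)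
apply: (@le_trans _ _ (\int[P]_t
    ((1 - s)^-1%:E * \sum_(1 <= n < K.+1) f n t))%E).
  apply: ge0_le_integral => //.
  - by move=> t _; rewrite lee_fin sqr_ge0.
  - by apply/measurable_EFinP; apply: measurable_funX; exact: measurable_total_error.
  - by apply: emeasurable_funM => //; exact: emeasurable_sum.
  move=> t _; rewrite sumEFin lee_fin.
  apply: (le_trans (@sqr_sum_le_weighted _ (fun n => s ^+ n) _ _ _)).
    by move=> n; rewrite exprn_gt0.
  rewrite ler_pM//.
    by apply: sumr_ge0 => n _; rewrite mulr_ge0 ?sqr_ge0.
  by apply: ler_sum => n _; rewrite mulrC.
rewrite ge0_integralZl_EFin//; last 3 first.
- by move=> t _; exact: sume_ge0.
- exact: emeasurable_sum.
- by rewrite invr_ge0 subr_ge0 ltW.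
rewrite ge0_integral_sum//.
have -> : C / (1 - s) ^+ 2 = (1 - s)^-1 * (C * (1 - s)^-1).
  by rewrite mulrCA expr2 invfM.
rewrite EFinM lee_wpmul2l//; first by rewrite lee_fin invr_ge0 subr_ge0 ltW.
rewrite big_nat (le_trans (lee_sum _ (fun n n1 => intf n (andP n1).1)))//.
rewrite -big_nat sumEFin lee_fin -mulr_sumr ler_wpM2l//.
Qed.

End total_error.

(** * From bounded second moments to vanishing mean and variance *)

Section vanishing_scaling.
Context d (T : measurableType d) (R : realType) (P : probability T R).

Lemma Lfun2_of_sqr_integral (X : T -> R) (M : R) : measurable_fun [set: T] X ->
  (\int[P]_t (X t ^+ 2)%:E <= M%:E)%E -> X \in Lfun P 2%:E.
Proof.
move=> mX XM; rewrite inE; apply/andP; split; rewrite inE//=.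
rewrite /finite_norm unlock poweR_lty//.
rewrite (le_lt_trans _ (ltry M))// (le_trans _ XM)// le_eqVlt; apply/orP; left.
apply/eqP; apply: eq_integral => t _ /=.
by rewrite powR_mulrn// -normrX ger0_norm// sqr_ge0.
Qed.

(** Both limits follow by squeezing from 0: the mean is at most [(1 + M) / sqrt K], and the variance
    at most the second moment, hence at most [M / K]. *)
Lemma expectation_variance_cvg0 (Y X : nat -> T -> R) (M : R) :
  (forall K, measurable_fun [set: T] (Y K)) -> (forall K t, 0 <= Y K t) ->
  (forall K, (\int[P]_t (Y K t ^+ 2)%:E <= M%:E)%E) ->
  (forall K t, X K t = (Num.sqrt K%:R)^-1 * Y K t) ->
  [/\ forall K, X K \in Lfun P 2%:E,
      ('E_P[X K] @[K --> \oo] --> 0)%E & ('V_P[X K] @[K --> \oo] --> 0)%E].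
Proof.
move=> mY Y_ge0 YM XE.
have X_eq K : X K = (fun t => (Num.sqrt K%:R)^-1 * Y K t) by apply/funext => t.
have X_ge0 K t : 0 <= X K t by rewrite XE mulr_ge0 ?invr_ge0 ?sqrtr_ge0.
have mX K : measurable_fun [set: T] (X K) by rewrite X_eq; exact: measurable_funM.
have mX2 K : measurable_fun [set: T] (fun t => (X K t ^+ 2)%:E).
  by apply/measurable_EFinP; exact: measurable_funX.
(* At [K = 0] the convention that 0 has inverse 0 makes both sides vanish. *)
have X2_le K : (\int[P]_t (X K t ^+ 2)%:E <= (M / K%:R)%:E)%E.
  under eq_integral do rewrite XE exprMn EFinM.
  rewrite ge0_integralZl_EFin ?sqr_ge0//; last 2 first.
  - by move=> t _; rewrite lee_fin sqr_ge0.
  - by apply/measurable_EFinP; exact: measurable_funX.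
  rewrite exprVn sqr_sqrtr// mulrC EFinM lee_wpmul2l// lee_fin invr_ge0//.
have LX K : X K \in Lfun P 2%:E by exact: Lfun2_of_sqr_integral (X2_le K).
have invK : (K%:R^-1 : R) @[K --> \oo] --> (0 : R).
  (* The harmonic sequence is indexed as [1 / (K + 1)], hence the shift. *)
  by rewrite -(cvg_shiftS (fun K => K%:R^-1 : R)); exact: cvg_harmonic.
have X1_le K : ('E_P[X K] <= ((Num.sqrt K%:R)^-1 * (1 + M))%:E)%E.
  rewrite unlock.
  apply: (@le_trans _ _ (\int[P]_t ((Num.sqrt K%:R)^-1%:E *
      ((1%:E : \bar R) + (Y K t ^+ 2)%:E)))%E).
    apply: ge0_le_integral => //.
    - by move=> t _; rewrite lee_fin.
    - exact/measurable_EFinP.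
    - apply: emeasurable_funM => //; apply: emeasurable_funD => //.
      by apply/measurable_EFinP; exact: measurable_funX.
    move=> t _; rewrite XE lee_fin ler_wpM2l ?invr_ge0 ?sqrtr_ge0//.
    (* For [y >= 0], expanding [(y - 1) ^ 2 >= 0] gives [y <= 2 y <= 1 + y ^ 2]. *)
    by have := sqr_ge0 (Y K t - 1); have := Y_ge0 K t; nra.
  rewrite ge0_integralZl_EFin ?invr_ge0 ?sqrtr_ge0//; last 2 first.
  - by move=> t _; rewrite adde_ge0// lee_fin sqr_ge0.
  - apply: emeasurable_funD => //.
    by apply/measurable_EFinP; exact: measurable_funX.
  rewrite ge0_integralD//; last 2 first.
  - by move=> t _; rewrite lee_fin sqr_ge0.
  - by apply/measurable_EFinP; exact: measurable_funX.
  rewrite integral_cst// [X in (1 * X)%E](probability_setT P) mul1e EFinM EFinD.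
  by rewrite lee_wpmul2l ?lee_fin ?invr_ge0 ?sqrtr_ge0// leeD2l.
split=> //.
- apply: (@squeeze_cvge _ _ _ _ (fun=> 0%E) _
      (fun K => ((Num.sqrt K%:R)^-1 * (1 + M))%:E)).
  + by apply: nearW => K; rewrite X1_le expectation_ge0.
  + exact: cvg_cst.
  apply: cvg_EFin; first exact: nearW.
  rewrite -[X in _ --> X](mul0r (1 + M)); apply: cvgMr_tmp.
  have := continuous_cvg _ (@sqrt_continuous R 0) invK; rewrite sqrtr0 => sK.
  rewrite (_ : (fun K => _) = (fun K => Num.sqrt K%:R^-1 : R)); first exact: sK.
  by apply/funext => K; rewrite sqrtrV.
- apply: (@squeeze_cvge _ _ _ _ (fun=> 0%E) _ (fun K => (M * K%:R^-1)%:E)).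
  (* The variance is the second moment minus the squared mean, so it is at most the second
     moment. *)
  + apply: nearW => K; rewrite variance_ge0/= varianceE//.
    rewrite (le_trans _ (X2_le K))// unlock.
    by rewrite geeDl// oppe_le0 sqre_ge0.
  + exact: cvg_cst.
  apply: cvg_EFin; first exact: nearW.
  by rewrite -[X in _ --> X](mulr0 M); apply: cvgMl_tmp.
Qed.

End vanishing_scaling.

(** * Mean and variance of the scaled error *)

Theorem theorem4p2 (R : realType) (d : measure_display) (T : measurableType d)
    (P : probability T R) (L : nat) (hL : (1 <= L)%N)
    (b : int -> {RV P >-> L.-tuple bool})
    (b_indep : mutually_independent b)
    (b_unif : forall n : int, uniform_block (b n)) :
  (forall Q K : nat, (0 < Q)%N -> (0 < K)%N ->
     P.-integrable [set: T] (EFin \o scaled_error R b Q K) /\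
     'V_P[scaled_error R b Q K]%E \is a fin_num) /\
  (forall Q : nat, (0 < Q)%N ->
     ('E_P[scaled_error R b Q K]%E @[K --> \oo] --> 0%E) /\
     ('V_P[scaled_error R b Q K]%E @[K --> \oo] --> 0%E)).
Proof.
(* The ratio is [q = 1 - 2^-L]; its positivity uses [L >= 1]. *)
have q01 : 0 < 1 - (2^-1 : R) ^+ L < 1.
  have h_lt1 : (2^-1 : R) < 1 by rewrite invf_lt1 ?ltr1n.
  by rewrite subr_gt0 exprn_ilt1// -lt0n hL/= gtrBl exprn_gt0.
have limits Q : (0 < Q)%N ->
  [/\ forall K, scaled_error R b Q K \in Lfun P 2%:E,
      ('E_P[scaled_error R b Q K] @[K --> \oo] --> 0)%E &
      ('V_P[scaled_error R b Q K] @[K --> \oo] --> 0)%E].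
  move=> Q_gt0.
  apply: (expectation_variance_cvg0 (Y := total_error b Q)) => //.
  - by move=> K; exact: measurable_total_error.
  - by move=> K t; exact: total_error_ge0.
  - move=> K; apply: (expectation_sqr_total_error_le q01) => // n m.
    exact: no_recurrence_prob_le.
split=> [Q K Q_gt0 _|Q /limits[]//].
have [LX _ _] := limits Q Q_gt0; split; last exact: variance_fin_num.
(* Square integrability implies integrability because [P] is finite. *)
by apply/Lfun1_integrable; apply: Lfun_subset12 (LX K); exact: fin_num_measure.
Qed.
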